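(* The deterministic value-query complexity of finding an EFX allocation satisfies $$D_{\mathrm{sub}}[EFX_{id}(2,2k+1)]\in\Omega\!\left(\frac{1}{k}\binom{2k+1}{k}\right).$$ Here there are two players who share one identical submodular valuation on $2k+1$ goods. In particular, the bound holds for the general problem with arbitrary valuations.
   Context: Goods form a finite set $M$. A valuation is a function $v:2^M\to\mathbb{R}_{\ge 0}$ with $v(\emptyset)=0$ that is monotone: $v(S)\le v(T)$ whenever $S\subseteq T$. It is submodular if $v(S\cup\{x\})-v(S)\ge v(T\cup\{x\})-v(T)$ for all $S\subseteq T$ and $x\notin T$. An allocation is an ordered partition $(A_1,\dots,A_n)$ of $M$; parts may be empty. It is EFX if for all players $i,j$ and every $g\in A_j$ we have $v_i(A_i)\ge v_i(A_j\setminus\{g\})$. $D_{\mathrm{sub}}[EFX_{id}(n,m)]$ is defined as follows. All $n$ players share one valuation $v$ on $M=[m]$, restricted to be submodular. The algorithm learns about $v$ only through adaptive value queries, where querying a set $S$ returns $v(S)$, and must output an EFX allocation. The quantity is the minimum, over deterministic algorithms, of the maximum, over such $v$, of the number of queries used. *)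

(* Defs.v *)
From HB Require Import structures.
From mathcomp Require Import all_boot all_order all_algebra.
Set Implicit Arguments. Unset Strict Implicit. Unset Printing Implicit Defensive.
Import Order.TTheory GRing.Theory Num.Theory.
Local Open Scope ring_scope.

Definition valuation (R : realFieldType) (m : nat) (v : {set 'I_m} -> R) : Prop :=
  [/\ v set0 = 0,
      (forall X : {set 'I_m}, 0 <= v X) &
      (forall X Y : {set 'I_m}, X \subset Y -> v X <= v Y)].

Definition submodular (R : realFieldType) (m : nat) (v : {set 'I_m} -> R) : Prop :=
  forall (U W : {set 'I_m}) (x : 'I_m), U \subset W -> x \notin W ->
    v (x |: W) - v W <= v (x |: U) - v U.

(* An allocation (ordered partition of the goods, parts possibly empty)
   is given by assigning each good to a player. *)
Definition allocation (m n : nat) := {ffun 'I_m -> 'I_n}.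

Definition bundle (m n : nat) (A : allocation m n) (i : 'I_n) : {set 'I_m} :=
  [set g | A g == i].

Definition EFX (R : realFieldType) (m n : nat) (vs : 'I_n -> {set 'I_m} -> R)
    (A : allocation m n) : Prop :=
  forall (i j : 'I_n) (g : 'I_m), g \in bundle A j ->
    vs i (bundle A j :\ g) <= vs i (bundle A i).

(* Deterministic adaptive value-query algorithms as decision trees:
   either output an allocation, or query a set S and continue depending
   on the answer v(S). *)
Inductive qtree (R : Type) (m n : nat) : Type :=
| Output : allocation m n -> qtree R m n
| Query : {set 'I_m} -> (R -> qtree R m n) -> qtree R m n.

Fixpoint run (R : Type) (m n : nat) (t : qtree R m n) (v : {set 'I_m} -> R)
  : allocation m n :=
  match t with
  | Output A => A
  | Query Q k => run (k (v Q)) v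
  end.

Fixpoint nqueries (R : Type) (m n : nat) (t : qtree R m n) (v : {set 'I_m} -> R)
  : nat :=
  match t with
  | Output _ => 0%N
  | Query Q k => (nqueries (k (v Q)) v).+1
  end.

Definition solves_EFX_id_sub (R : realFieldType) (m n : nat) (t : qtree R m n) : Prop :=
  forall v : {set 'I_m} -> R, valuation v -> submodular v ->
    EFX (fun _ : 'I_n => v) (run t v).

(* Main.v *)
Require Import Defs.
From HB Require Import structures.
From mathcomp Require Import all_boot all_order all_algebra.
From mathcomp Require Import all_fingroup.
From mathcomp Require Import zify.
Import Order.TTheory GRing.Theory Num.Theory.
Set Implicit Arguments. Unset Strict Implicit. Unset Printing Implicit Defensive.

(* Perturb a steep concave function of |S| by a small function w on the sets of
   size k.  The result is monotone and submodular, and one of the two bundles X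
   of an EFX allocation has size k and is a local maximum of w in the odd graph,
   whose vertices are the k-sets and whose edges join disjoint k-sets.

   The odd graph expands: any two vertices x, y are joined by a path on at most
   2k+1 vertices.  Averaging these paths over the permutations of the goods, the
   number of pairs of vertices separated by a set Q of vertices is at most
   N (2k+1) |Q|, with N = C(2k+1, k).  Hence, as long as 2 (2k+1) |Q| < N, some
   component of the complement of Q has more than N/2 vertices.

   The adversary keeps the local maximum inside this giant component.  When a
   query makes the component shrink to C', it fixes w on the discarded vertices
   by decreasing distance to C', above all earlier values; every vertex outside
   C' then has a neighbor which is better or lies in C'.  An algorithm that stops
   too early and outputs X is refuted by shrinking the component to a single
   vertex other than X. *)

(** * The odd graph and its short walks *)

Definition kset (k : nat) : {set {set 'I_(2 * k + 1)}} := [set x : {set _} | #|x| == k].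

Definition edge (k : nat) (Q : {set {set 'I_(2 * k + 1)}}) :
    rel {set 'I_(2 * k + 1)} :=
  fun x y => [&& x \in kset k :\: Q, y \in kset k :\: Q & [disjoint x & y]].

(** The guard makes the component empty unless [x] is a vertex outside [Q]; [connect] alone is
    reflexive. *)
Definition component (k : nat) (Q : {set {set 'I_(2 * k + 1)}})
    (x : {set 'I_(2 * k + 1)}) : {set {set 'I_(2 * k + 1)}} :=
  [set y | (x \in kset k :\: Q) && connect (edge Q) x y].

Lemma card_kset (k : nat) : #|kset k| = 'C(2 * k + 1, k).
Proof. by rewrite card_draws card_ord. Qed.

Lemma tperm_imset_swap (T : finType) (y : {set T}) (a b : T) :
  a \notin y -> b \in y -> tperm a b @: y = a |: (y :\ b).
Proof.
move=> ay yb; apply/setP=> c; apply/imsetP/idP=> [[d dy ->]|].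
  rewrite !inE; case: tpermP => [da||_ /eqP db].
  - by rewrite -da dy in ay.
  - by rewrite eqxx.
  - by rewrite db dy orbT.
rewrite !inE => /orP[/eqP->|/andP[cb cy]].
  by exists b => //; rewrite tpermR.
exists c => //; rewrite tpermD // eq_sym //.
by apply: contraNneq ay => <-.
Qed.

(** Exchanging [b] in [x :\: y] for [a] in [y :\: x] costs two edges, through the complement of
    [a |: x], which is disjoint from both k-sets. The product of these transpositions is [g], so
    permutations act transitively on k-sets. *)
Lemma kset_walk (k : nat) (x y : {set 'I_(2 * k + 1)}) :
  x \in kset k -> y \in kset k ->
  exists (s : seq {set 'I_(2 * k + 1)}) (g : {perm 'I_(2 * k + 1)}),
    [/\ path (edge set0) x s, last x s = y, size s = (2 * #|x :\: y|)%N
      & g @: x = y].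
Proof.
move=> + Vy; have [n] := ubnP #|x :\: y|; elim: n x => // n IHn x xyn Vx.
have [xy0|/set0Pn[b bxy]] := eqVneq (x :\: y) set0.
  have xy : x = y.
    apply/eqP; rewrite eqEcard -setD_eq0 xy0 eqxx /=.
    by move: Vx Vy; rewrite !inE => /eqP -> /eqP ->.
  exists [::], 1%g; split=> //; first by rewrite xy0 cards0.
  by rewrite -[RHS]imset_id xy; apply: eq_imset => i; rewrite perm1.
have cxy : #|x :\: y| = #|y :\: x|.
  move: Vx Vy; rewrite !inE !cardsD (setIC y x) => /eqP -> /eqP ->; lia.
have /set0Pn[a ayx] : y :\: x != set0.
  by rewrite -card_gt0 -cxy card_gt0; apply/set0Pn; exists b.
move: bxy ayx; rewrite !inE => /andP[by_ bx] /andP[ax ay].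
pose x1 := a |: (x :\ b); pose z := ~: (a |: x).
have ab : a != b by apply: contraNneq ax => ->.
have x1E : tperm a b @: x = x1 by apply: tperm_imset_swap.
have Vx1 : x1 \in kset k.
  by rewrite inE -x1E (card_imset _ perm_inj); move: Vx; rewrite inE.
have Vz : z \in kset k.
  rewrite inE cardsCs setCK cardsU1 ax card_ord; move: Vx; rewrite inE => /eqP ->.
  by apply/eqP; lia.
have x1y : #|x :\: y| = #|x1 :\: y|.+1.
  rewrite (cardsD1 b) !inE by_ bx add1n; congr _.+1; apply: eq_card => c.
  rewrite !inE; have [->|_] := eqVneq c a; first by rewrite ay andbF.
  by case: (c == b); rewrite ?andbF.
have [s [g [ps ls ss gx]]] := IHn x1 ltac:(lia) Vx1.
exists (z :: x1 :: s), (tperm a b * g)%g; split=> //=.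
- rewrite ps /edge !setD0 Vx Vz Vx1 /= andbT -!setI_eq0.
  apply/andP; split; apply/eqP/setP=> c; rewrite !inE.
    by case: (c \in x); rewrite ?orbT ?andbF.
  by case: (c \in x); case: (c == a); rewrite ?orbT ?andbF.
- by rewrite ss x1y mulnS.
- by rewrite -gx -x1E -imset_comp; apply: eq_imset => i; rewrite permM.
Qed.

(** * Expansion by averaging over permutations *)

Lemma kset_perm (k : nat) (x : {set 'I_(2 * k + 1)}) (g : {perm 'I_(2 * k + 1)}) :
  (g @: x \in kset k) = (x \in kset k).
Proof. by rewrite !inE (card_imset _ perm_inj). Qed.

(** Right translation by a permutation carrying [z] to [y] matches the permutations sending [x] to
    [z] with those sending [x] to [y], so all fibres have equal size. *)
Lemma card_perm_to (k : nat) (x y : {set 'I_(2 * k + 1)}) :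
  x \in kset k -> y \in kset k ->
  (#|kset k| * #|[set g : {perm 'I_(2 * k + 1)} | g @: x == y]|
   = #|{perm 'I_(2 * k + 1)}|)%N.
Proof.
move=> Vx Vy; rewrite -sum_nat_const -[RHS]cardsT.
rewrite -[RHS]sum1_card.
rewrite (partition_big (fun g : {perm _} => g @: x) (mem (kset k))) /=; last first.
  by move=> g _; rewrite kset_perm.
apply: eq_bigr => z Vz; rewrite -sum1_card.
have [_ [h [_ _ _ hyz]]] := kset_walk Vz Vy.
rewrite [RHS](reindex_inj (mulIg h^-1)%g) /=.
apply: eq_bigl => g; rewrite !inE.
have -> : (g * h^-1)%g @: x = h^-1%g @: (g @: x).
  by rewrite -imset_comp; apply: eq_imset => i; rewrite permM.
have <- : h^-1%g @: y = z.
  rewrite -hyz -imset_comp -[RHS]imset_id; apply: eq_imset => i.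
  by rewrite /= permK.
by rewrite (inj_eq (imset_inj perm_inj)).
Qed.

Lemma card_perm_into (k : nat) (Q : {set {set 'I_(2 * k + 1)}})
    (x : {set 'I_(2 * k + 1)}) :
  x \in kset k ->
  (#|kset k| * #|[set g : {perm 'I_(2 * k + 1)} | g @: x \in Q]|
   <= #|Q| * #|{perm 'I_(2 * k + 1)}|)%N.
Proof.
move=> Vx; rewrite -[X in (_ * X <= _)%N]sum1_card.
rewrite (partition_big (fun g : {perm _} => g @: x) (mem Q)) /=; last first.
  by move=> g; rewrite inE.
rewrite big_distrr /= -sum_nat_const; apply: leq_sum => y Qy.
have [Vy|nVy] := boolP (y \in kset k).
  rewrite -(card_perm_to Vx Vy) leq_mul // sum1dep_card.
  by apply/subset_leq_card/subsetP => g; rewrite !inE => /andP[].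
rewrite big1 ?muln0 // => g; rewrite inE => /andP[_ /eqP gx].
by rewrite -gx kset_perm Vx in nVy.
Qed.

Lemma edge_perm (k : nat) (Q : {set {set 'I_(2 * k + 1)}})
    (g : {perm 'I_(2 * k + 1)}) (x y : {set 'I_(2 * k + 1)}) :
  edge set0 x y -> g @: x \notin Q -> g @: y \notin Q ->
  edge Q (g @: x) (g @: y).
Proof.
rewrite /edge !setD0 => /and3P[Vx Vy xy] Qx Qy.
by rewrite !in_setD !kset_perm Vx Vy Qx Qy /= imset_disjoint //; apply: perm_inj.
Qed.

(** If [Q] separates the images of [x] and [y], the image of a fixed walk between them meets [Q]; a
    union bound over its at most 2k+1 vertices suffices. *)
Lemma card_perm_sep (k : nat) (Q : {set {set 'I_(2 * k + 1)}})
    (x y : {set 'I_(2 * k + 1)}) :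
  x \in kset k -> y \in kset k ->
  (#|kset k| *
     #|[set g : {perm 'I_(2 * k + 1)} | g @: y \notin component Q (g @: x)]|
   <= (2 * k + 1) * #|Q| * #|{perm 'I_(2 * k + 1)}|)%N.
Proof.
move=> Vx Vy; have [s [_ [ps lsy ss _]]] := kset_walk Vx Vy.
have Vs : {subset x :: s <= kset k}.
  move=> z; rewrite inE => /orP[/eqP->//|].
  elim: s (x) ps {lsy ss} => [//|u s IHs] v /= /andP[/and3P[_ + _] /IHs us].
  by rewrite setD0 => Vu; rewrite in_cons => /orP[/eqP->|/us].
have le1 : (#|[set g : {perm 'I_(2 * k + 1)} | g @: y \notin component Q (g @: x)]|
    <= \sum_(z <- x :: s) #|[set g : {perm 'I_(2 * k + 1)} | g @: z \in Q]|)%N.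
  apply: leq_trans (_ : (#|\bigcup_(z <- x :: s)
      [set g : {perm 'I_(2 * k + 1)} | g @: z \in Q]| <= _)%N); last first.
    elim/big_rec2: _ => [|z a b _ le]; first by rewrite cards0.
    by rewrite (leq_trans (leq_card_setU _ _)) ?leq_add2l.
  apply/subset_leq_card/subsetP => g; rewrite inE; apply: contraR.
  move=> ng; have {ng} nQ z : z \in x :: s -> g @: z \notin Q.
    move=> zs; apply: contra ng => gz; rewrite (big_rem z) //=.
    by rewrite !inE gz.
  rewrite in_set in_setD nQ ?mem_head // kset_perm Vx /= -lsy.
  elim: s (x) ps nQ {lsy ss Vs Vx} => [//|u s IHs] v /= /andP[vu us] nQ.
  apply: connect_trans (IHs u us _); last first.
    by move=> z zs; apply: nQ; rewrite inE zs orbT.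
  by apply/connect1/edge_perm => //; apply: nQ; rewrite !inE eqxx ?orbT.
apply: leq_trans (leq_mul (leqnn _) le1) _; rewrite big_distrr /= -mulnA.
apply: leq_trans (_ : \sum_(z <- x :: s) #|Q| * #|{perm 'I_(2 * k + 1)}| <= _)%N.
  by rewrite !big_seq; apply: leq_sum => z /Vs; apply: card_perm_into.
rewrite big_const_seq count_predT iter_addn_0 mulnC leq_mul //= ss.
have := subset_leq_card (subsetDl x y); move: Vx; rewrite inE => /eqP -> /=; lia.
Qed.

(** Relabelling the vertices by [g] leaves the sum unchanged, so it equals its average over all [g],
    which is bounded pair by pair. *)
Lemma card_sep (k : nat) (Q : {set {set 'I_(2 * k + 1)}}) :
  (\sum_(x in kset k) #|kset k :\: component Q x|
   <= #|kset k| * ((2 * k + 1) * #|Q|))%N.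
Proof.
set V := kset k.
have G0 : (0 < #|{perm 'I_(2 * k + 1)}|)%N by apply/card_gt0P; exists 1%g.
have V0 : (0 < #|V|)%N by rewrite card_kset bin_gt0; lia.
have E (g : {perm 'I_(2 * k + 1)}) : (\sum_(x in V) #|V :\: component Q x|
    = \sum_(x in V) \sum_(y in V) (g @: y \notin component Q (g @: x)))%N.
  have bij : bijective (fun x : {set _} => g @: x).
    by apply: injF_bij; apply: imset_inj; apply: perm_inj.
  rewrite (reindex _ (onW_bij _ bij)) /=; apply: eq_big => x; first by rewrite kset_perm.
  move=> _; rewrite -sum1_card big_mkcond (reindex _ (onW_bij _ bij)) /=.
  rewrite [RHS]big_mkcond; apply: eq_bigr => y _.
  by rewrite in_setD kset_perm; case: (y \in V); case: (_ \in component _ _).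
have {}E : (#|{perm 'I_(2 * k + 1)}| * \sum_(x in V) #|V :\: component Q x|
    = \sum_(g : {perm 'I_(2 * k + 1)})
        \sum_(x in V) \sum_(y in V) (g @: y \notin component Q (g @: x)))%N.
  by rewrite -sum_nat_const; apply: eq_bigr.
rewrite -(leq_pmul2l V0) -(leq_pmul2l G0) mulnCA E exchange_big /=.
under eq_bigr do rewrite exchange_big /=.
apply: leq_trans (_ : \sum_(x in V) \sum_(y in V)
   ((2 * k + 1) * #|Q| * #|{perm 'I_(2 * k + 1)}|) <= _)%N; last first.
  by rewrite !sum_nat_const [leqRHS]mulnC -!mulnA.
rewrite big_distrr leq_sum //= => x Vx; rewrite big_distrr leq_sum //= => y Vy.
apply: leq_trans (card_perm_sep Q Vx Vy); rewrite leq_mul //.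
rewrite -sum1_card [leqRHS]big_mkcond /=.
by apply: leq_sum => g _; rewrite [g \in _]in_set; case: (_ \notin _).
Qed.

(** Otherwise every vertex would be separated from at least half of all vertices, against
    [card_sep]. *)
Lemma giant_comp (k : nat) (Q : {set {set 'I_(2 * k + 1)}}) :
  (2 * ((2 * k + 1) * #|Q|) < #|kset k|)%N ->
  exists x, (#|kset k| < 2 * #|component Q x|)%N.
Proof.
move=> Qsmall; apply/existsP; apply: contraLR Qsmall; rewrite negb_exists -leqNgt.
move=> /forallP small; have V0 : (0 < #|kset k|)%N by rewrite card_kset bin_gt0; lia.
rewrite -(leq_pmul2l V0) mulnCA.
apply: leq_trans (leq_mul (leqnn 2) (card_sep Q)).
rewrite big_distrr /= -sum_nat_const leq_sum //= => x Vx.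
have := small x; rewrite -leqNgt cardsD mulnBr leq_subRL; last first.
  by rewrite leq_mul // subset_leq_card // subsetIl.
rewrite [(2 * #|kset k|)%N]mul2n -addnn leq_add2r => /(leq_trans _); apply.
by rewrite leq_mul // subset_leq_card // subsetIr.
Qed.

(** * Shrinking components and committed values *)

Lemma exists_rank (T : finType) (e : rel T) (B : {set T}) :
  exists d : T -> nat, (forall y, d y <= #|T|)%N /\
    forall y z, y \notin B -> z \in B -> connect e y z ->
      exists2 u, e y u & (d u < d y)%N.
Proof.
pose P y n := [exists s : n.-tuple T, path e y s && (last y s \in B)].
have Pd y : (find (P y) (iota 0 #|T|) <= #|T|)%N.
  by rewrite -{2}(size_iota 0 #|T|) find_size.
(* This is the length of a shortest path into [B], or [#|T|] by default if there is none; lengths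
   below [#|T|] suffice because a path can be made duplicate-free. *)
exists (fun y => find (P y) (iota 0 #|T|)); split => // y z yB zB.
case/connectP => s es zE; case/shortenP: es zE => s' es' us' _ zE.
have hP : has (P y) (iota 0 #|T|).
  apply/hasP; exists (size s').
    by rewrite mem_iota -[(size s').+1]/(size (y :: s')) -(card_uniqP us') max_card.
  by apply/existsP; exists (in_tuple s'); rewrite es' -zE zB.
have dlt := hP; rewrite has_find size_iota in dlt.
have := nth_find 0 hP; rewrite nth_iota // add0n.
set n := find _ _ in dlt *; case/existsP => -[r /= /eqP rn] /andP[].
case: r rn => [_ _ /= |u r /= rn /andP[yu ur] lB]; first by rewrite (negbTE yB).
exists u => //; rewrite leqNgt; apply/negP; rewrite ltnS => le.
have := @before_find _ 0 (P u) (iota 0 #|T|) (size r).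
rewrite -rn in le; move/(_ le); rewrite nth_iota ?add0n; last by lia.
by case/existsP; exists (in_tuple r); rewrite ur lB.
Qed.

(** A neighbor in [C] counts as better because values there are still open and will be set above the
    committed ones. *)
Definition climbs (k : nat) (C : {set {set 'I_(2 * k + 1)}})
    (w : {set 'I_(2 * k + 1)} -> nat) : Prop :=
  forall y, y \in kset k -> y \notin C ->
    exists z, [/\ z \in kset k, [disjoint y & z] & z \in C \/ (w y < w z)%N].

Lemma edge_sym (k : nat) (Q : {set {set 'I_(2 * k + 1)}}) : symmetric (edge Q).
Proof. by move=> x y; rewrite /edge disjoint_sym andbCA. Qed.

Lemma mem_component (k : nat) (Q : {set {set 'I_(2 * k + 1)}})
    (x y : {set 'I_(2 * k + 1)}) :
  y \in component Q x ->
  [/\ x \in kset k :\: Q, y \in kset k :\: Q & connect (edge Q) x y].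
Proof.
rewrite inE => /andP[Vx xy]; split=> //.
case/connectP: xy => s; elim: s x Vx => [|u s IHs] x Vx /=; first by move=> _ ->.
by case/andP => /and3P[_ Vu _] us; apply: IHs.
Qed.

(** Two sets with more than half of the vertices meet, and enlarging [Q] only refines
    connectivity. *)
Lemma component_sub (k : nat) (Q Q' : {set {set 'I_(2 * k + 1)}})
    (x x' : {set 'I_(2 * k + 1)}) :
  Q \subset Q' -> (#|kset k| < 2 * #|component Q x|)%N ->
  (#|kset k| < 2 * #|component Q' x'|)%N ->
  component Q' x' \subset component Q x.
Proof.
move=> QQ' big big'.
have VQ q v z : z \in component q v -> z \in kset k.
  by case/mem_component => _; case/setDP.
have /set0Pn[u] : component Q x :&: component Q' x' != set0.
  apply: contraTneq big' => cc0; rewrite -leqNgt.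
  have := subset_leq_card (_ : component Q x :|: component Q' x' \subset kset k).
  rewrite cardsU cc0 cards0 subn0 => /(_ _)/(leq_trans _) le.
  have {}le : (#|component Q x| + #|component Q' x'| <= #|kset k|)%N.
    apply: le => //; apply/subsetP => z; rewrite in_setU.
    by case/orP => /VQ.
  lia.
rewrite in_setI => /andP[/mem_component[Vx _ xu] /mem_component[_ _ x'u]].
have sub : subrel (connect (edge Q')) (connect (edge Q)).
  apply: connect_sub => a b /and3P[Va Vb ab]; apply: connect1.
  by rewrite /edge ab !(subsetP (setDS _ QQ')).
apply/subsetP => y /mem_component[_ _ x'y]; rewrite inE Vx /=.
apply: (connect_trans xu); apply: sub; apply: (connect_trans _ x'y).
by rewrite (sym_connect_sym (@edge_sym _ _)).
Qed.

Lemma climbs_extend (k : nat) (Q C' : {set {set 'I_(2 * k + 1)}})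
    (x z : {set 'I_(2 * k + 1)}) (w : {set 'I_(2 * k + 1)} -> nat) (M : nat) :
  C' \subset component Q x -> z \in C' -> climbs (component Q x) w ->
  (forall y, y \in kset k -> y \notin component Q x -> (w y < M)%N) ->
  exists w', [/\ forall y, y \notin component Q x -> w' y = w y,
    forall y, y \in kset k -> y \notin C' ->
      (w' y < M + #|{set 'I_(2 * k + 1)}|.+1)%N
    & climbs C' w'].
Proof.
move=> CC' zC' clw wM.
have [d [dle dP]] := exists_rank (edge Q) C'.
set K := #|_| in dle *.
(* New values are at least [M], hence above all old ones, and increase toward [C'] since [d y <= K].
   Those on [C'] itself are provisional. *)
exists (fun y => if y \in component Q x then (M + (K - d y))%N else w y).
split=> [y /negbTE-> // | y Vy yC' | y Vy yC'].
  have [yC|nyC] := boolP (y \in component Q x); first by lia.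
  by have := wM y Vy nyC; lia.
have [yC|nyC] := boolP (y \in component Q x).
  have [Vx VQy xy] := mem_component yC.
  have [_ _ xz] := mem_component (subsetP CC' _ zC').
  have [|u yu du] := dP y z yC' zC'.
    apply: connect_trans xz; by rewrite (sym_connect_sym (@edge_sym _ _)).
  have uC : u \in component Q x.
    by rewrite inE Vx /= (connect_trans xy) ?connect1.
  have [_ VQu yudisj] := and3P yu; exists u.
  split=> //; first by case/setDP: VQu.
  by right; rewrite uC ltn_add2l ltn_sub2l // (leq_trans du).
have [u [Vu yu H]] := clw y Vy nyC; exists u; split=> //.
right; case: ifP => uC; first exact: ltn_addr (wM y Vy nyC).
by case: H => //; rewrite uC.
Qed.

(** * The perturbed concave valuation *)

(** For s at most 2m this is m^2 - (m - s)^2, strictly increasing up to m and strictly concave. *)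
Definition parabola (m s : nat) : nat := (s * (2 * m - s))%N.

Lemma parabola_incr (m a b : nat) :
  (a < b <= m -> parabola m a < parabola m b)%N.
Proof.
move=> /andP[ab bm]; rewrite /parabola.
have -> : (2 * m - a = m + (m - b) + (b - a))%N by lia.
have -> : (2 * m - b = m + (m - b))%N by lia.
have -> : b = (a + (b - a))%N by lia.
nia.
Qed.

Lemma parabola_concave (m a b : nat) : (a < b < m ->
  parabola m b.+1 + parabola m a < parabola m a.+1 + parabola m b)%N.
Proof.
move=> /andP[ab bm]; rewrite /parabola.
have [d Eb] : exists d, b = (a + d.+1)%N by exists (b - a.+1)%N; lia.
have [c Em] : exists c, m = (b + c.+1)%N by exists (m - b.+1)%N; lia.
subst b m.
have -> : (2 * (a + d.+1 + c.+1) - (a + d.+1).+1 = a + d + 2 * c + 2)%N by lia.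
have -> : (2 * (a + d.+1 + c.+1) - a = a + 2 * d + 2 * c + 4)%N by lia.
have -> : (2 * (a + d.+1 + c.+1) - a.+1 = a + 2 * d + 2 * c + 3)%N by lia.
have -> : (2 * (a + d.+1 + c.+1) - (a + d.+1) = a + d + 2 * c + 3)%N by lia.
nia.
Qed.

(** The parabola is integer valued, so the factor [B] turns its strict inequalities into gaps of at
    least [B], which absorb any [w] bounded by [B]. *)
Definition bump_value (k B : nat) (w : {set 'I_(2 * k + 1)} -> nat)
    (S : {set 'I_(2 * k + 1)}) : nat :=
  (B * parabola (2 * k + 1) #|S| + (if #|S| == k then w S else 0))%N.

Lemma bump_value_lt (k B : nat) (w : {set 'I_(2 * k + 1)} -> nat)
    (X Y : {set 'I_(2 * k + 1)}) :
  (0 < B)%N -> (#|X| < k)%N -> (#|X| < #|Y|)%N ->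
  (bump_value B w X < bump_value B w Y)%N.
Proof.
move=> B0 Xk XY; rewrite /bump_value (ltn_eqF Xk) addn0 ltn_addr //.
rewrite ltn_pmul2l // parabola_incr // XY.
by rewrite -[leqRHS]card_ord max_card.
Qed.

Lemma bump_value_mono (k B : nat) (w : {set 'I_(2 * k + 1)} -> nat)
    (X Y : {set 'I_(2 * k + 1)}) :
  (forall S, S \in kset k -> w S <= B)%N -> X \subset Y ->
  (bump_value B w X <= bump_value B w Y)%N.
Proof.
move=> wB; rewrite subEproper => /orP[/eqP->//|/proper_card XY].
have wX : ((if #|X| == k then w X else 0) <= B)%N.
  by case: eqP => // /eqP Xk; apply: wB; rewrite inE.
apply: leq_trans (leq_addr _ _); apply: leq_trans (leq_add (leqnn _) wX) _.
rewrite addnC -mulnS leq_mul // parabola_incr // XY.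
by rewrite -[leqRHS]card_ord max_card.
Qed.

Lemma bump_value_submod (k B : nat) (w : {set 'I_(2 * k + 1)} -> nat)
    (U W : {set 'I_(2 * k + 1)}) (x : 'I_(2 * k + 1)) :
  (forall S, S \in kset k -> w S <= B)%N -> U \subset W -> x \notin W ->
  (bump_value B w (x |: W) + bump_value B w U
   <= bump_value B w (x |: U) + bump_value B w W)%N.
Proof.
move=> wB; rewrite subEproper => /orP[/eqP->|UW] xW; first by rewrite addnC.
have xU : x \notin U by apply: contra xW; apply/subsetP/proper_sub.
have Wm : (#|W| < 2 * k + 1)%N.
  rewrite -[ltnRHS]card_ord -cardsT; apply: proper_card.
  by rewrite properT; apply: contraNneq xW => ->; rewrite inE.
have bnd (S : {set _}) : ((if #|S| == k then w S else 0) <= B)%N.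
  by case: eqP => // /eqP Sk; apply: wB; rewrite inE.
(* Since [U] is smaller than [x |: W], at most one of them is a k-set, so a single [B] covers both
   perturbations. *)
have one : ((if #|x |: W| == k then w (x |: W) else 0)
        + (if #|U| == k then w U else 0) <= B)%N.
  have [Wk|_] := eqVneq #|x |: W| k; last exact: bnd.
  rewrite [#|U| == k]ltn_eqF ?addn0 ?wB ?inE ?Wk //.
  by rewrite -[ltnRHS]Wk cardsU1 xW (ltn_trans (proper_card UW)).
have := @parabola_concave (2 * k + 1) #|U| #|W|.
rewrite Wm proper_card //= => /(_ isT)/(leq_mul (leqnn B)).
rewrite mulnS !(mulnDr B (parabola _ _)) /bump_value => conc.
rewrite addnACA [leqRHS]addnACA; apply: leq_trans (leq_addr _ _).
apply: leq_trans (leq_add (leqnn _) one) _; rewrite addnC.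
by move: conc; rewrite !cardsU1 xW xU !add1n.
Qed.

Lemma bump_value_valuation (R : realFieldType) (k B : nat)
    (w : {set 'I_(2 * k + 1)} -> nat) :
  (forall S, S \in kset k -> w S <= B)%N -> (0 < k)%N ->
  valuation (fun S : {set _} => (bump_value B w S)%:R%R : R).
Proof.
move=> wB k0; split=> [|X|X Y XY]; last by rewrite ler_nat bump_value_mono.
  by rewrite /bump_value cards0 (ltn_eqF k0) /parabola mul0n muln0.
exact: ler0n.
Qed.

Lemma bump_value_submodular (R : realFieldType) (k B : nat)
    (w : {set 'I_(2 * k + 1)} -> nat) :
  (forall S, S \in kset k -> w S <= B)%N ->
  submodular (fun S : {set _} => (bump_value B w S)%:R%R : R).
Proof.
move=> wB U W x UW xW.
by rewrite lerBlDr addrAC lerBrDr -!natrD ler_nat bump_value_submod.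
Qed.

(** * EFX allocations between two players *)

Lemma bundle_compl (m : nat) (a : allocation m 2) (i j : 'I_2) :
  i != j -> bundle a j = ~: bundle a i.
Proof.
move=> ij; apply/setP => g; rewrite !inE.
by case: (a g) i j ij => [[|[|]] //= ?] [[|[|]] //= ?] [[|[|]] //= ?].
Qed.

Lemma bundle_le_half (k : nat) (a : allocation (2 * k + 1) 2) :
  exists i j : 'I_2, i != j /\ (#|bundle a i| <= k)%N.
Proof.
have := cardsC (bundle a ord0); rewrite -(@bundle_compl _ a ord0 ord_max) // card_ord.
case: (leqP #|bundle a ord0| k) => [le _|lt E]; first by exists ord0, ord_max.
exists ord_max, ord0; split=> //; lia.
Qed.

Lemma not_EFX (R : realFieldType) (m : nat) (v : {set 'I_m} -> R)
    (a : allocation m 2) (i j : 'I_2) (Z : {set 'I_m}) :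
  valuation v -> i != j -> Z \proper ~: bundle a i ->
  (v (bundle a i) < v Z)%R -> ~ EFX (fun=> v) a.
Proof.
move=> [_ _ mono] ij /properP[ZX [g gX gZ]] ltZ /(_ i j g).
rewrite (bundle_compl _ ij) => /(_ gX); apply/negP; rewrite -ltNge.
by apply: lt_le_trans ltZ _; apply: mono; rewrite subsetD1 ZX gZ.
Qed.

Lemma card_kset_gt1 (k : nat) : (0 < k)%N -> (1 < #|kset k|)%N.
Proof.
case: k => // k _; rewrite card_kset addn1 binS.
have /= := bin_gt0 (2 * k.+1) k.+1; have := bin_gt0 (2 * k.+1) k; lia.
Qed.

(** A neighbor [z] of a bundle of size k is the other bundle less one good. If the bundle is
    smaller, the other one remains larger after any removal. *)
Lemma not_EFX_bump_value (R : realFieldType) (k B : nat)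
    (w : {set 'I_(2 * k + 1)} -> nat) (a : allocation (2 * k + 1) 2)
    (i j : 'I_2) :
  (0 < k)%N -> (0 < B)%N -> (forall S, S \in kset k -> w S <= B)%N ->
  i != j -> (#|bundle a i| <= k)%N ->
  (bundle a i \in kset k -> exists z, [/\ z \in kset k,
     [disjoint bundle a i & z] & (w (bundle a i) < w z)%N]) ->
  ~ EFX (fun=> (fun S : {set _} => (bump_value B w S)%:R%R : R)) a.
Proof.
move=> k0 B0 wB ij; have vP := bump_value_valuation R wB k0.
have := cardsC (bundle a i); rewrite card_ord => cC.
rewrite leq_eqVlt => /orP[Xk /(_ _)|Xk _].
  case=> [|z [Vz Xz wz]]; first by rewrite inE.
  apply: (not_EFX (Z := z) vP ij).
    rewrite properEcard; move: Vz; rewrite inE => /eqP ->.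
    by rewrite -disjoints_subset disjoint_sym Xz; lia.
  rewrite ltr_nat /bump_value Xk (eqP Xk); move: Vz; rewrite inE => /eqP ->.
  by rewrite eqxx ltn_add2l.
have /card_gt0P[g gX] : (0 < #|~: bundle a i|)%N by lia.
have := cardsD1 g (~: bundle a i); rewrite gX add1n => cD.
apply: (not_EFX (Z := ~: bundle a i :\ g) vP ij); first exact: properD1.
by rewrite ltr_nat bump_value_lt //; lia.
Qed.

(** * The adversary and the lower bound *)

(* Only the values of [w] off the component of [x] are committed; the [l]-th query
   commits values in the [l]-th block of [K] integers. *)
Lemma adversary (R : realFieldType) (k : nat) (t : qtree R (2 * k + 1) 2)
    (K := #|{set 'I_(2 * k + 1)}|.+1) (N := #|kset k|)
    (Q : {set {set 'I_(2 * k + 1)}}) (x : {set 'I_(2 * k + 1)})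
    (w : {set 'I_(2 * k + 1)} -> nat) (l : nat) :
  (0 < k)%N -> (#|Q| <= l)%N -> (2 * ((2 * k + 1) * l) < N)%N ->
  (N < 2 * #|component Q x|)%N -> climbs (component Q x) w ->
  (forall y, y \in kset k -> y \notin component Q x -> w y < l * K)%N ->
  exists w' (v := fun S : {set _} => (bump_value (N * K) w' S)%:R%R : R),
    [/\ forall y, y \in kset k -> y \notin component Q x -> w' y = w y,
        (forall S, S \in kset k -> w' S <= N * K)%N
      & (N <= 2 * ((2 * k + 1) * (l + nqueries t v)))%N
        \/ ~ EFX (fun=> v) (run t v)].
Proof.
move=> k0; elim: t Q x w l => [a|S f IHt] Q x w l Ql lN big clw wM.
  have [i [j [ij Xk]]] := bundle_le_half a.
  set X := bundle a i in Xk *.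
  have lltN : (l < N)%N by apply: leq_ltn_trans lN; nia.
  have /set0Pn[z] : component Q x :\ X != set0.
    have C1 : (1 < #|component Q x|)%N.
      by have := leq_ltn_trans (card_kset_gt1 k0) big; lia.
    apply: contraTneq C1 => CX0.
    by rewrite (cardsD1 X) CX0 cards0 addn0 -leqNgt leq_b1.
  rewrite in_setD1 => /andP[zX zC].
  have [|w2 [agree w2M clw2]] :=
    @climbs_extend k Q [set z] x z w (l * K) _ (set11 z) clw wM.
    by rewrite sub1set.
  have lK : (l * K + K <= N * K)%N by rewrite addnC -mulSn leq_mul.
  (* Raising [z] above all values of [w2] elsewhere leaves [X] with a strictly better neighbor. *)
  exists (fun y => if y == z then (l * K + K)%N else w2 y) => v; split.
  - move=> y _ yC; rewrite agree //; case: eqP => // yz; by rewrite yz zC in yC.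
  - move=> y Vy; case: eqP => // /eqP yz.
    by apply: leq_trans lK; apply/ltnW/w2M => //; rewrite in_set1.
  right; apply: (@not_EFX_bump_value R k (N * K) _ a i j) => //.
  + by rewrite muln_gt0 andbT; apply: leq_ltn_trans lltN.
  + move=> y Vy; case: eqP => // /eqP yz.
    by apply: leq_trans lK; apply/ltnW/w2M => //; rewrite in_set1.
  rewrite -/X => VX; have Xz : X \notin [set z] by rewrite inE eq_sym.
  have [u [Vu Xu H]] := clw2 X VX Xz; exists u; split=> //.
  rewrite eq_sym (negbTE zX); case: eqP => [_|uz]; first exact: w2M.
  by case: H => //; rewrite inE => /eqP.
have [lN'|lN'] := ltnP (2 * ((2 * k + 1) * l.+1)) N; last first.
  have lltN : (l <= N)%N by apply: ltnW; apply: leq_ltn_trans lN; nia.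
  (* The current query already brings the count to [l.+1], which meets the bound, so any completion
     of [w] will do. *)
  exists (fun y => if y \in component Q x then 0%N else w y) => v; split.
  - by move=> y _ /negbTE ->.
  - move=> y Vy; case: ifPn => // yC.
    by apply: (leq_trans (ltnW (wM y Vy yC))); rewrite leq_mul.
  by left; apply: leq_trans lN' _; rewrite !leq_mul //= addnS ltnS leq_addr.
have Q'l : (#|S |: Q| <= l.+1)%N.
  by rewrite cardsU1; apply: (leq_add (leq_b1 _) Ql).
have [x' big'] : exists x', (N < 2 * #|component (S |: Q) x'|)%N.
  apply: giant_comp; apply: leq_ltn_trans lN'; by rewrite !leq_mul.
have sub : component (S |: Q) x' \subset component Q x.
  exact: component_sub (subsetUr _ _) big big'.
have /card_gt0P[z zC'] : (0 < #|component (S |: Q) x'|)%N by lia.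
have [w2 [agree2 w2M clw2]] := climbs_extend sub zC' clw wM.
have {}w2M y : y \in kset k -> y \notin component (S |: Q) x' ->
    (w2 y < l.+1 * K)%N.
  by move=> Vy yC; rewrite mulSn addnC w2M.
have [w' [agree' w'M H]] :=
  IHt (bump_value (N * K) w2 S)%:R%R _ _ _ _ Q'l lN' big' clw2 w2M.
exists w' => v; split=> //.
  move=> y Vy yC; rewrite agree' ?agree2 //.
  by apply: contra yC; apply/subsetP.
(* The answer stays correct: either [S] is not a k-set and [w] does not matter, or [S] lies in the
   new [Q] and its value is committed. *)
have vS : v S = (bump_value (N * K) w2 S)%:R%R.
  rewrite /v /bump_value; case: eqP => // /eqP Sk; rewrite agree' //.
    by rewrite inE.
  by apply/negP => /mem_component[_]; rewrite in_setD setU11.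
by rewrite /= vS -[(l + _)%N]addSnnS.
Qed.

Lemma component_set0 (k : nat) (x : {set 'I_(2 * k + 1)}) :
  x \in kset k -> component set0 x = kset k.
Proof.
move=> Vx; apply/setP => y; apply/idP/idP.
  by case/mem_component => _; rewrite setD0.
move=> Vy; rewrite inE setD0 Vx /=.
by have [s [_ [ps <- _ _]]] := kset_walk Vx Vy; apply/connectP; exists s.
Qed.

(* D_sub[EFX_id(2, 2k+1)] is in Omega( (1/k) * binom(2k+1, k) ):
   there are constants a > 0 and k0 such that for all k >= k0, every
   deterministic algorithm solving EFX_id(2,2k+1) on submodular valuations
   uses, on some submodular valuation, at least binom(2k+1,k) / (a*k) queries. *)
Theorem theorem3p6 :
  exists (a k0 : nat), (0 < a)%N /\
    forall (R : realFieldType) (k : nat), (k0 <= k)%N ->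
    forall t : qtree R (2 * k + 1) 2,
      solves_EFX_id_sub t ->
      exists v : {set 'I_(2 * k + 1)} -> R,
        [/\ valuation v, submodular v &
            ('C(2 * k + 1, k) <= a * k * nqueries t v)%N].
Proof.
(* The constant 6 comes from 2(2k+1) <= 6k for k >= 1. *)
exists 6, 1; split=> // R k k0 t tP.
have N1 := card_kset_gt1 k0.
have /card_gt0P[x Vx] : (0 < #|kset k|)%N by lia.
have C0 := component_set0 Vx.
(* Before any query the component is the whole graph, so nothing is committed and [climbs] is
   vacuous. *)
have [|||||w' /= [_ w'B H]] :=
  @adversary R k t set0 x (fun=> 0) 0 k0.
- by rewrite cards0.
- by rewrite !muln0; lia.
- by rewrite C0; lia.
- by move=> y Vy; rewrite C0 Vy.
- by move=> y Vy; rewrite C0 Vy.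
have vP := bump_value_valuation R w'B k0.
have vS := bump_value_submodular R w'B.
exists (fun S : {set _} =>
  (bump_value (#|kset k| * #|{set 'I_(2 * k + 1)}|.+1) w' S)%:R%R).
split=> //; rewrite -card_kset.
case: H => [le|]; last by case; apply: tP.
by apply: leq_trans le _; rewrite add0n mulnA leq_mul //; lia.
Qed.
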